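(* The ring of invariants $\mathbb{C}[x_1,\dots,x_n]^{G(r,n)}$ is the polynomial ring $$\mathbb{C}[x]^{G(r,n)}=\mathbb{C}[E_1,\dots,E_n],\qquad E_h(x):=e_h(x_1^r,\dots,x_n^r)\quad(1\le h\le n),$$ i.e. it is generated as a $\mathbb{C}$-algebra by the algebraically independent polynomials $E_1,\dots,E_n$. The polynomial $E_h$ is homogeneous of degree $rh$.
   Context: Let $n,r\ge1$ be integers, $\mu_r$ the group of $r$-th roots of unity in $\mathbb{C}$, and $G(r,n)=\mu_r^n\rtimes S_n$ acting on $\mathbb{C}^n$ by $(\zeta_1,\dots,\zeta_n;\sigma)\cdot(x_1,\dots,x_n)=(\zeta_1x_{\sigma^{-1}(1)},\dots,\zeta_nx_{\sigma^{-1}(n)})$. A polynomial $\phi$ is $G(r,n)$-invariant if $\phi(g\cdot x)=\phi(x)$ for all $g\in G(r,n)$. $e_h$ denotes the $h$-th elementary symmetric function in $n$ variables. *)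

(* Defs.v *)
From HB Require Import structures.
From mathcomp Require Import all_boot all_order all_fingroup all_algebra.
From mathcomp Require Import reals complex mpoly.

Set Implicit Arguments.
Unset Strict Implicit.
Unset Printing Implicit Defensive.

Import GRing.Theory.
Local Open Scope ring_scope.

(* The complex numbers are R[i] for R : realType. *)

Section RootsOfUnity.
Variables (R : realType) (r : nat).

Definition mu := {z : R[i] | r.-unity_root z}.

Lemma mu_mul_subproof (z w : mu) : r.-unity_root (val z * val w).
Proof.
apply/unity_rootP; rewrite exprMn.
by rewrite (unity_rootP (valP z)) (unity_rootP (valP w)) mulr1.
Qed.

Lemma mu_one_subproof : r.-unity_root (1 : R[i]).
Proof. by apply/unity_rootP; rewrite expr1n. Qed.

Lemma mu_inv_subproof (z : mu) : r.-unity_root (val z)^-1.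
Proof. by apply/unity_rootP; rewrite exprVn (unity_rootP (valP z)) invr1. Qed.

Definition mu_mul (z w : mu) : mu := Sub _ (mu_mul_subproof z w).
Definition mu_one : mu := Sub _ mu_one_subproof.
Definition mu_inv (z : mu) : mu := Sub _ (mu_inv_subproof z).

End RootsOfUnity.

Section MonomialGroup.
Variables (R : realType) (r n : nat).

Definition Grn := ({ffun 'I_n -> mu R r} * 'S_n)%type.
Implicit Types g h k : Grn.

Definition Grn_act g (x : 'I_n -> R[i]) : 'I_n -> R[i] :=
  fun i => val (g.1 i) * x ((g.2^-1)%g i).

(* Permutations compose from left to right in MathComp: (s * t) i = t (s i).
   The composite "h.2 first, then g.2" is therefore h.2 * g.2. *)
Definition Grn_mul g h : Grn :=
  ([ffun i => mu_mul (g.1 i) (h.1 ((g.2^-1)%g i))], (h.2 * g.2)%g).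

Definition Grn_one : Grn := ([ffun => mu_one R r], 1%g).

Definition Grn_inv g : Grn := ([ffun i => mu_inv (g.1 (g.2 i))], (g.2^-1)%g).

Lemma Grn_mulA g h k : Grn_mul g (Grn_mul h k) = Grn_mul (Grn_mul g h) k.
Proof.
congr pair; last by rewrite mulgA.
apply/ffunP=> i; rewrite !ffunE; apply: val_inj => /=.
by rewrite mulrA invMg permM.
Qed.

Lemma Grn_mul1 g : Grn_mul Grn_one g = g.
Proof.
case: g => z s; congr pair; last by rewrite mulg1.
apply/ffunP=> i; rewrite !ffunE; apply: val_inj => /=.
by rewrite mul1r invg1 perm1.
Qed.

Lemma Grn_mulV g : (0 < r)%N -> Grn_mul (Grn_inv g) g = Grn_one.
Proof.
move=> r_gt0; congr pair; last by rewrite mulgV.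
apply/ffunP=> i; rewrite !ffunE; apply: val_inj => /=.
rewrite invgK mulVf //; apply/eqP=> z0.
have := unity_rootP (valP (g.1 (g.2 i))).
by rewrite /= z0 expr0n eqn0Ngt r_gt0 => /esym/eqP; rewrite oner_eq0.
Qed.

Lemma Grn_act1 x : Grn_act Grn_one x =1 x.
Proof. by move=> i; rewrite /Grn_act /= ffunE mul1r invg1 perm1. Qed.

Lemma Grn_actM g h x :
  Grn_act (Grn_mul g h) x =1 Grn_act g (Grn_act h x).
Proof. by move=> i; rewrite /Grn_act /= ffunE /= invMg permM mulrA. Qed.

Definition Grn_invariant (phi : {mpoly R[i][n]}) : Prop :=
  forall (g : Grn) (x : 'I_n -> R[i]), phi.@[Grn_act g x] = phi.@[x].

End MonomialGroup.

Section Generation.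
Variables (R : realType) (m n : nat).

Definition in_generated_algebra (F : m.-tuple {mpoly R[i][n]})
    (phi : {mpoly R[i][n]}) : Prop :=
  exists q : {mpoly R[i][m]}, phi = q \mPo F.

Definition algebraically_independent (F : m.-tuple {mpoly R[i][n]}) : Prop :=
  forall q : {mpoly R[i][m]}, q \mPo F = 0 -> q = 0.

End Generation.

Section Generators.
Variables (R : realType) (r n : nat).

Definition E_ (h : nat) : {mpoly R[i][n]} :=
  mesym n R[i] h \mPo [tuple 'X_i ^+ r | i < n].

(* The index i : 'I_n starts at 0, so this is (E_1, ..., E_n). *)
Definition E_tuple : n.-tuple {mpoly R[i][n]} := [tuple E_ i.+1 | i < n].

End Generators.

(* Main.v *)
(* Invariance under the diagonal torus mu_r^n means that every monomial of phi
   has all its exponents divisible by r, so phi(x) = psi(x_1^r, ..., x_n^r) for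
   a unique psi; invariance under S_n then says that psi is symmetric, and the
   fundamental theorem on symmetric polynomials applies to psi. *)

Require Import Defs.
From mathcomp Require Import all_boot all_order all_fingroup all_algebra.
From mathcomp Require Import all_solvable all_field.
From mathcomp Require Import reals complex mpoly.

Import GRing.Theory.
Local Open Scope ring_scope.

(** Since [r] is invertible, $X^r - 1$ is separable and has $r$ distinct roots; that many $r$-th
    roots of unity must include a primitive one. *)
Lemma prim_root_exists (F : closedFieldType) (r : nat) :
  r%:R != 0 :> F -> exists z : F, r.-primitive_root z.
Proof.
move=> r_neq0.
have r_gt0 : (0 < r)%N by case: r r_neq0 => //; rewrite eqxx.
have [rs] := closed_field_poly_normal ('X^r - 1 : {poly F}).
rewrite (monicP _) ?monicXnsubC // scale1r => Xr1E.
have /hasP[z _ prim_z] : has r.-primitive_root rs; last by exists z.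
apply: has_prim_root => //.
- by apply/allP=> z; rewrite -root_prod_XsubC -Xr1E.
- by rewrite -separable_prod_XsubC -Xr1E separable_Xn_sub_1.
- by rewrite -ltnS -(size_prod_XsubC rs id) -Xr1E size_XnsubC.
Qed.

Section MPolyComplements.
Context (n : nat).

(** Used to read one coefficient off a sum over the support; the second hypothesis covers [k]
    outside it. *)
Lemma big_msupp1 (R : nzRingType) (V : nmodType) (p : {mpoly R[n]})
    (F : 'X_{1..n} -> V) (k : 'X_{1..n}) :
    (forall m, m != k -> F m = 0) -> (p@_k = 0 -> F k = 0) ->
  \sum_(m <- msupp p) F m = F k.
Proof.
move=> F0 Fk0; have [k_in|k_notin] := boolP (k \in msupp p).
  by rewrite (bigD1_seq k) ?msupp_uniq //= big1 ?addr0.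
rewrite Fk0 ?memN_msupp_eq0 // big_seq big1 // => m m_in.
by rewrite F0 //; apply: contraNneq k_notin => <-.
Qed.

Lemma meval_msym (R : comNzRingType) (s : 'S_n) (p : {mpoly R[n]}) x :
  (msym s p).@[x] = p.@[x \o s].
Proof.
rewrite -[msym s p]comp_mpoly_id msym_mPo comp_mpoly_meval.
by apply: meval_eq => i; rewrite !tnth_mktuple mevalXU.
Qed.

Lemma comp_mpolyA (R : comNzRingType) k l (p : {mpoly R[k]})
    (f : k.-tuple {mpoly R[l]}) (g : l.-tuple {mpoly R[n]}) :
  (p \mPo f) \mPo g = p \mPo [tuple tnth f i \mPo g | i < k].
Proof.
rewrite [p \mPo f]comp_mpolyEX [RHS]comp_mpolyEX raddf_sum /=.
apply: eq_bigr => m _; rewrite comp_mpolyZ !comp_mpolyX rmorph_prod /=.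
by congr (_ *: _); apply: eq_bigr => i _; rewrite rmorphXn tnth_mktuple.
Qed.

End MPolyComplements.

Lemma mcoeff_muni (R : nzRingType) n (p : {mpoly R[n.+1]}) (m : 'X_{1..n.+1}) :
  ((muni p)`_(m ord_max))@_[multinom m (widen_ord (leqnSn n) i) | i < n] = p@_m.
Proof.
rewrite muniE coef_sum raddf_sum (big_msupp1 _ _ _ _ _ m) /=.
- by rewrite coefZ coefXn eqxx mulr1 mcoeffZ mcoeffX eqxx mulr1.
- move=> k neq_km; rewrite coefZ coefXn.
  have [Emax|] := eqVneq; last by rewrite mulr0 mcoeff0.
  rewrite mulr1 mcoeffZ mcoeffX; case: eqP => [/mnmP Ewiden|]; last by rewrite mulr0.
  (* An exponent vector is determined by its last entry ([Emax]) and the others ([Ewiden]). *)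
  case/eqP: neq_km; apply/mnmP => i; case: (unliftP ord_max i) => [j ->|->] //.
  have := Ewiden j; rewrite !mnmE.
  by have -> : lift ord_max j = widen_ord (leqnSn n) j by apply/val_inj/lift_max.
- by move=> pm0; rewrite pm0 !scale0r coef0 mcoeff0.
Qed.

Lemma meval_muni (R : comNzRingType) n (p : {mpoly R[n.+1]}) x :
  p.@[x] = (map_poly (meval (fun i => x (widen_ord (leqnSn n) i))) (muni p)).[x ord_max].
Proof.
rewrite muniE mevalE raddf_sum horner_sum /=; apply: eq_bigr => m _.
rewrite map_polyZ /= map_polyXn hornerZ hornerXn mevalZ mevalX -mulrA.
rewrite big_ord_recr /=; congr (_ * (_ * _)).
by apply: eq_bigr => i _; rewrite mnmE.
Qed.

(** Induction on [n]: with the first variables fixed, the polynomial in the last one has too many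
    roots, so its coefficients vanish at every point and the induction hypothesis applies to
    them. *)
Lemma meval_inj (R : numDomainType) n (p q : {mpoly R[n]}) :
  (forall x, p.@[x] = q.@[x]) -> p = q.
Proof.
move=> eq_pq; apply/eqP; rewrite -subr_eq0; apply/eqP.
have {eq_pq}: forall x, (p - q).@[x] = 0 by move=> x; rewrite mevalB eq_pq subrr.
elim: n {p q}(p - q) => [|n IHn] p p0.
  apply/mpolyP => m; rewrite mcoeff0; have := p0 (fun=> 0).
  rewrite mevalE (big_msupp1 _ _ _ _ _ m) ?big_ord0 ?mulr1 //.
  by move=> k /eqP[]; apply/mnmP => -[].
have muni0 i : (muni p)`_i = 0.
  apply: IHn => v; pose P := map_poly (meval v) (muni p).
  suff : P = 0 by move/(congr1 (coefp i)); rewrite /= coef_map coef0.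
  (* In characteristic zero these are [size P] distinct points, more than a nonzero [P] can have as
     roots. *)
  pose rs := [seq k%:R : R | k <- iota 0 (size P)].
  apply: (@roots_geq_poly_eq0 _ P rs); last by rewrite size_map size_iota.
    apply/allP => c _; apply/rootP.
    (* The point with last coordinate [c] and the other coordinates given by [v]. *)
    rewrite -[RHS](p0 (fun i => oapp v c (unlift ord_max i))).
    rewrite meval_muni unlift_none /=; congr _.[_].
    apply: eq_map_poly => s; apply: meval_eq => j.
    have -> : widen_ord (leqnSn n) j = lift ord_max j by apply/val_inj/esym/lift_max.
    by rewrite liftK.
  by rewrite map_inj_uniq ?iota_uniq //; apply/Num.Theory.mulrIn/oner_neq0.
by apply/mpolyP => m; rewrite -mcoeff_muni muni0 !mcoeff0.
Qed.

Section PowerSubstitution.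
Context (R : comNzRingType) (n r : nat).
Implicit Types (p : {mpoly R[n]}) (m : 'X_{1..n}).

Definition Xpow : n.-tuple {mpoly R[n]} := [tuple 'X_i ^+ r | i < n].

Lemma mpolyX_Xpow m : 'X_[m] \mPo Xpow = 'X_[(m *+ r)%MM].
Proof.
rewrite comp_mpolyX [RHS]mpolyXE_id; apply: eq_bigr => i _.
by rewrite tnth_mktuple mulmnE -exprM mulnC.
Qed.

Lemma Xpow_of_dvd p :
    (forall m i, m \in msupp p -> (r %| m i)%N) ->
  exists q : {mpoly R[n]}, p = q \mPo Xpow.
Proof.
move=> dvd_p; exists (\sum_(m <- msupp p) p@_m *: 'X_[[multinom m i %/ r | i < n]]).
rewrite {1}[p]mpolyE raddf_sum /=; apply: eq_big_seq => m m_in.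
rewrite comp_mpolyZ mpolyX_Xpow; congr (_ *: 'X_[_]); apply/mnmP => i.
by rewrite mulmnE mnmE divnK ?dvd_p.
Qed.

Hypothesis r_gt0 : (0 < r)%N.

(** For $r > 0$ multiplication of exponents by $r$ is injective, so distinct monomials of [p] never
    merge. *)
Lemma mcoeff_Xpow p m : (p \mPo Xpow)@_(m *+ r) = p@_m.
Proof.
rewrite comp_mpolyEX raddf_sum (big_msupp1 _ _ _ _ _ m) /=.
- by rewrite mpolyX_Xpow mcoeffZ mcoeffX eqxx mulr1.
- move=> k neq_km; rewrite mpolyX_Xpow mcoeffZ mcoeffX.
  case: eqP => [/mnmP eq_km|]; last by rewrite mulr0.
  case/eqP: neq_km; apply/mnmP => i; have := eq_km i; rewrite !mulmnE.
  by move/eqP; rewrite eqn_pmul2r // => /eqP.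
- by move->; rewrite scale0r mcoeff0.
Qed.

Lemma Xpow_eq0 p : p \mPo Xpow = 0 -> p = 0.
Proof. by move=> p0; apply/mpolyP => m; rewrite -mcoeff_Xpow p0 !mcoeff0. Qed.

(** Permuting exponents commutes with multiplying them by $r$, so the coefficients can be compared
    after substitution. *)
Lemma Xpow_symmetric p : p \mPo Xpow \is symmetric -> p \is symmetric.
Proof.
move=> sym; apply/issymP => s; apply/mpolyP => m.
rewrite mcoeff_sym -[LHS]mcoeff_Xpow -[RHS]mcoeff_Xpow.
rewrite -(msym_coeff (m *+ r)%MM s sym); congr (mcoeff _ _).
by apply/mnmP => i; rewrite !(mnmE, mulmnE).
Qed.

Lemma dhomog_Xpow p d : p \is d.-homog -> p \mPo Xpow \is (r * d).-homog.
Proof.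
move=> /dhomogP hom; rewrite comp_mpolyEX big_seq; apply: rpred_sum => m m_in.
by apply: dhomogZ; rewrite mpolyX_Xpow dhomogX /= mdegMn hom // mulnC.
Qed.

End PowerSubstitution.

Lemma mcoeff_scaleX (R : comNzRingType) n (z : 'I_n -> R) (p : {mpoly R[n]}) m :
  (p \mPo [tuple z i *: 'X_i | i < n])@_m = p@_m * \prod_i z i ^+ m i.
Proof.
have scaleX k : 'X_[k] \mPo [tuple z i *: 'X_i | i < n] =
    (\prod_i z i ^+ k i) *: 'X_[k] :> {mpoly R[n]}.
  rewrite comp_mpolyX [in RHS]mpolyXE_id -scaler_prod; apply: eq_bigr => i _.
  by rewrite tnth_mktuple exprZn.
rewrite comp_mpolyEX raddf_sum (big_msupp1 _ _ _ _ _ m) /=.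
- by rewrite scaleX !mcoeffZ mcoeffX eqxx mulr1.
- by move=> k /negPf neq_km; rewrite scaleX !mcoeffZ mcoeffX neq_km !mulr0.
- by move->; rewrite scale0r mcoeff0.
Qed.

Section Invariants.
Context (R : realType) (n r : nat).
Hypothesis r_gt0 : (0 < r)%N.
Implicit Types phi : {mpoly R[i][n]}.

Local Notation mesyms := [tuple mesym n R[i] i.+1 | i < n].

(** Splits the substitution of the generators in two, so that the theory of elementary symmetric
    polynomials handles one factor and the coefficient formula for [Xpow] the other. *)
Lemma comp_E_tuple (q : {mpoly R[i][n]}) :
  q \mPo E_tuple R r n = (q \mPo mesyms) \mPo Xpow R[i] n r.
Proof.
rewrite [RHS]comp_mpolyA; apply: (congr1 (fun E => q \mPo E)).
by apply: eq_from_tnth => i; rewrite [LHS]tnth_mktuple [RHS]tnth_mktuple tnth_mktuple.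
Qed.

Lemma Grn_invariant_symmetric phi : Grn_invariant r phi -> phi \is symmetric.
Proof.
move=> inv; apply/issymP => s; apply: meval_inj => x; rewrite meval_msym.
(* The action permutes coordinates by the inverse of its permutation, hence [s^-1] to obtain
   [x \o s]. *)
rewrite -(inv ([ffun=> mu_one R r], s^-1%g) x); apply: meval_eq => i.
by rewrite /Grn_act ffunE mul1r invgK.
Qed.

Lemma Grn_invariant_dvd phi :
  Grn_invariant r phi -> forall m i, m \in msupp phi -> (r %| m i)%N.
Proof.
move=> inv m i m_in.
have [|z prim_z] := prim_root_exists R[i] r.
  by rewrite Num.Theory.pnatr_eq0 -lt0n.
pose zeta : mu R r := Sub z (introT unity_rootP (prim_expr_order prim_z)).
(* Scaling only the [i]-th coordinate by the primitive root multiplies the coefficient at [m] by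
   [zeta] to the power [m i]. *)
pose t : {ffun 'I_n -> mu R r} := [ffun j => if j == i then zeta else mu_one R r].
have Ephi : phi \mPo [tuple val (t j) *: 'X_j | j < n] = phi.
  apply: meval_inj => x; rewrite comp_mpoly_meval -[RHS](inv (t, 1%g)).
  apply: meval_eq => j; rewrite tnth_mktuple mevalZ mevalXU.
  by rewrite /Grn_act /= invg1 perm1.
have := mcoeff_scaleX _ _ (fun j => val (t j)) phi m; rewrite Ephi.
rewrite (bigD1 i) //= big1 => [|j /negPf neq_ji]; last first.
  by rewrite ffunE neq_ji expr1n.
rewrite mulr1 ffunE eqxx -[LHS]mulr1.
(* The coefficient at [m] is nonzero and cancels, leaving $z^{m_i} = 1$. *)
move/(mulfI _); rewrite -mcoeff_msupp m_in => /(_ isT) /esym/eqP.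
by rewrite -(prim_order_dvd prim_z).
Qed.

(** Taking $r$-th powers kills the roots of unity, and the remaining permutation of the arguments is
    absorbed by the symmetry of [psi]. *)
Lemma symmetric_Xpow_Grn_invariant psi :
  psi \is symmetric -> Grn_invariant r (psi \mPo Xpow R[i] n r).
Proof.
move=> /issymP sym [z s] x.
rewrite !comp_mpoly_meval -[in RHS](sym s^-1%g) meval_msym.
apply: meval_eq => i; rewrite /= !tnth_mktuple !rmorphXn /= !mevalXU.
by rewrite /Grn_act exprMn (unity_rootP (valP (z i))) mul1r.
Qed.

End Invariants.

Theorem proposition2p1 (R : realType) (n r : nat)
    (hn : (1 <= n)%N) (hr : (1 <= r)%N) :
  [/\ forall phi : {mpoly R[i][n]},
        Grn_invariant r phi <-> in_generated_algebra (E_tuple R r n) phi,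
      algebraically_independent (E_tuple R r n) &
      forall h : nat, (1 <= h <= n)%N -> E_ R r n h \is (r * h).-homog].
Proof.
split=> [phi|q|h _]; last exact/dhomog_Xpow/dhomog_mesym.
- split=> [inv|[q ->]].
    have [psi phiE] := Xpow_of_dvd _ _ _ _ (Grn_invariant_dvd _ _ _ hr _ inv).
    have psi_sym : psi \is symmetric.
      by apply: (Xpow_symmetric _ _ _ hr); rewrite -phiE (Grn_invariant_symmetric _ _ _ _ inv).
    have [q [qE _]] := sym_fundamental psi_sym.
    by exists q; rewrite comp_E_tuple qE.
  (* A polynomial in the symmetric polynomials $e_1,\dots,e_n$ is itself symmetric. *)
  rewrite comp_E_tuple; apply: symmetric_Xpow_Grn_invariant.
  by apply: mcomp_sym => i; rewrite -tnth_nth tnth_mktuple mesym_sym.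
(* Substituting $r$-th powers is injective, which reduces the claim to the algebraic independence of
   $e_1,\dots,e_n$. *)
- by rewrite comp_E_tuple => /(Xpow_eq0 _ _ _ hr)/msym_fundamental_un0.
Qed.
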